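(* Let $s,t\ge 2$ be integers with $t=n-s+1$. Then $$\delta_s(0)=\delta_t(1)-2=2^{\gcd(t-1,n)}-2,\qquad \delta_s(1)=\delta_t(0)+2=2^{\gcd(t,n)},$$ and the following multisets are equal: $$\{\delta_s(b) : b\in\mathbb{F}_{2^n}\setminus\mathbb{F}_2\}=\{\delta_t(b) : b\in\mathbb{F}_{2^n}\setminus\mathbb{F}_2\}.$$ Moreover, $G_t$ and $G_s$ have the same differential spectrum if and only if $\gcd(s,n)=\gcd(t,n)=1$, which can hold for odd $n$ only. In any case, $G_t$ is locally-APN if and only if $G_s$ is locally-APN.
   Context: For $2\le\nu\le n-1$, $G_\nu$ is the function $x\mapsto x^{2^\nu-1}$ over $\mathbb{F}_{2^n}$, and for $b\in\mathbb{F}_{2^n}$, $\delta_\nu(b)=\#\{x\in\mathbb{F}_{2^n} : G_\nu(x+1)+G_\nu(x)=b\}$. The differential spectrum of $G_\nu$ is the family of numbers $\omega_i=\#\{b\in\mathbb{F}_{2^n} : \delta_\nu(b)=i\}$, $i\ge 0$. $G_\nu$ is called locally-APN if $\delta_\nu(b)\le 2$ for all $b\in\mathbb{F}_{2^n}\setminus\mathbb{F}_2$. *)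

(* Defs.v *)
From HB Require Import structures.
From mathcomp Require Import all_boot all_order all_algebra.

Set Implicit Arguments.
Unset Strict Implicit.
Unset Printing Implicit Defensive.

Import GRing.Theory.
Local Open Scope ring_scope.

(* The field GF(2^n) is rendered as a finFieldType F with #|F| = 2 ^ n, so F
   has characteristic 2; the definitions make sense over any finite field. *)

Definition G (F : finFieldType) (nu : nat) (x : F) : F := x ^+ (2 ^ nu - 1).

Definition delta (F : finFieldType) (nu : nat) (b : F) : nat :=
  #|[set x : F | G nu (x + 1) + G nu x == b]|.

Definition omega (F : finFieldType) (nu i : nat) : nat :=
  #|[set b : F | delta nu b == i]|.

(* In characteristic 2, the prime subfield of F. *)
Definition F2 (F : finFieldType) : {set F} := [set 0; 1].

Definition same_differential_spectrum (F : finFieldType) (mu nu : nat) : Prop :=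
  forall i : nat, omega F mu i = omega F nu i.

Definition locally_APN (F : finFieldType) (nu : nat) : Prop :=
  forall b : F, b \notin F2 F -> (delta nu b <= 2)%N.

(* The multiset { delta_nu(b) : b in F \ F_2 }, as a sequence; multisets are
   compared with perm_eq. *)
Definition delta_values (F : finFieldType) (nu : nat) : seq nat :=
  [seq delta nu b | b in ~: F2 F].

(* Main.v *)
Require Import Defs.
From HB Require Import structures.
From mathcomp Require Import all_boot all_order all_algebra all_field zify ring.

Set Implicit Arguments.
Unset Strict Implicit.
Unset Printing Implicit Defensive.

Import GRing.Theory.
Local Open Scope ring_scope.

(* For b <> 1 and x outside F_2, multiplying G_s(x + 1) + G_s(x) = b by
   x (x + 1) linearizes it to L_{s,b}(x) = x^(2^s) + b x^2 + (b + 1) x = 0, whose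
   kernel contains F_2, so that delta_s(b) + 2 = #ker L_{s,b}.  For b in F_2 this
   kernel consists of the fixed points of a power of the Frobenius.
   For b outside F_2, if s + t = n + 1 then Tr (L_{s,b}(x) y) = Tr (x^2 A_{t,b}(y))
   with A_{t,b}(y) = y^(2^t) + (b + 1)^2 y^2 + b y, so that L_{s,b} and A_{t,b}
   have kernels of the same size.  A nonzero l in ker A_{t,b} rescales A_{t,b}
   into L_{t,c} with c = b l^(1 - 2^t) + 1, and (b, l) |-> (c, l^(2^t)) injects the
   pairs (b, l), b not in F_2, l a nonzero element of ker A_{t,b}, into the
   analogous pairs for A_{s,c}.  Restricted to the b with #ker L_{s,b} = N there
   are N - 1 such l for each b; exchanging s and t shows that each N is attained
   equally often for s and for t. *)

(** * Iterated Frobenius and its fixed points *)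

Lemma exprXX (R : pzSemiRingType) (p i j : nat) (x : R) :
  x ^+ (p ^ i) ^+ (p ^ j) = x ^+ (p ^ (i + j)).
Proof. by rewrite -exprM expnD. Qed.

Lemma exprD_pchar2 (R : comNzSemiRingType) (k : nat) (x y : R) :
  2%N \in [pchar R] -> (x + y) ^+ (2 ^ k) = x ^+ (2 ^ k) + y ^+ (2 ^ k).
Proof. by move=> c2; rewrite exprDn_pchar // pnatX pnatE ?c2. Qed.

Lemma expX_fixed (R : pzSemiRingType) (p k m : nat) (x : R) :
  x ^+ (p ^ k) = x -> x ^+ (p ^ (m * k)) = x.
Proof. by move=> xk; elim: m => [|m IHm] //; rewrite mulSn -exprXX xk. Qed.

(** Induction on [m]: in characteristic 2, X^(2^((m+1)g)) - X is the sum of (X^(2^(mg)) - X)^(2^g)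
    and X^(2^g) - X. *)
Lemma dvdp_frob (R : idomainType) (g m : nat) :
  2%N \in [pchar R] ->
  ('X^(2 ^ g) - 'X : {poly R}) %| 'X^(2 ^ (m * g)) - 'X.
Proof.
move=> c2; have cP : 2%N \in [pchar {poly R}] by rewrite pchar_poly.
elim: m => [|m IHm]; first by rewrite subrr dvdp0.
rewrite mulSn addnC -exprXX.
rewrite -(subrKA ('X^(2 ^ g)) ('X^_ ^+ _)) dvdp_addl ?dvdpp //.
rewrite !(oppr_pchar2 cP) in IHm *; rewrite -exprD_pchar2 //.
apply: dvdp_trans IHm _; rewrite -{1}['X^_ + 'X]expr1; apply: dvdp_exp2l.
by rewrite expn_gt0.
Qed.

Section Char2.
Variables (n : nat) (F : finFieldType).
Hypothesis hF : #|F| = (2 ^ n)%N.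

Lemma two_pchar : 2%N \in [pchar F].
Proof. exact: card_finPcharP hF _. Qed.

Lemma addxx (x : F) : x + x = 0.
Proof. exact: addrr_pchar2 two_pchar x. Qed.

Lemma addr_eq0_pchar2 (x y : F) : (x + y == 0) = (x == y).
Proof. by rewrite addr_eq0 (oppr_pchar2 two_pchar). Qed.

Lemma n_gt0 : (0 < n)%N.
Proof.
by have := finNzRing_gt1 F; rewrite hF; case: (n).
Qed.

Lemma exprD_pow2 (k : nat) (x y : F) :
  (x + y) ^+ (2 ^ k) = x ^+ (2 ^ k) + y ^+ (2 ^ k).
Proof. exact: exprD_pchar2 two_pchar. Qed.

Lemma expf_pow2n (x : F) : x ^+ (2 ^ n) = x.
Proof. by rewrite -hF expf_card. Qed.

Lemma exp_pow2_inj (k : nat) : injective (fun x : F => x ^+ (2 ^ k)).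
Proof.
move=> x y /= e; apply/eqP; rewrite -subr_eq0.
have : (x - y) ^+ (2 ^ k) = 0.
  by rewrite (oppr_pchar2 two_pchar) exprD_pow2 e addxx.
by move/eqP; rewrite expf_eq0 => /andP[].
Qed.

Lemma frob_fixed_gcd (k : nat) (x : F) : (0 < k)%N ->
  (x ^+ (2 ^ k) == x) = (x ^+ (2 ^ gcdn k n) == x).
Proof.
move=> k_gt0; apply/eqP/eqP => [xk | xg]; last first.
  by rewrite -(divnK (dvdn_gcdl k n)) expX_fixed.
(* Bezout: [km * k = kn * n + gcdn k n], and the [kn * n]-fold Frobenius is the identity. *)
case: (egcdnP n k_gt0) => km kn e _.
by have := expX_fixed km xk; rewrite e -exprXX expX_fixed ?expf_pow2n.
Qed.

(** With g = gcd(k, n), X^(2^g) - X divides X^(2^n) - X, the product of all X - a for a in [F];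
    hence it splits into distinct linear factors and has 2^g roots. *)
Lemma card_frob_fixed (k : nat) : (0 < k)%N ->
  #|[set x : F | x ^+ (2 ^ k) == x]| = (2 ^ gcdn k n)%N.
Proof.
move=> k_gt0; set g := gcdn k n.
have g_gt0 : (0 < g)%N by rewrite gcdn_gt0 k_gt0.
have [m] : {m | ('X^(2 ^ g) - 'X : {poly F}) %=
                  \prod_(x <- mask m (index_enum F)) ('X - x%:P)}.
  apply: dvdp_prod_XsubC; rewrite -finField_genPoly hF.
  by rewrite -(divnK (dvdn_gcdr k n)) dvdp_frob // two_pchar.
set r := mask _ _ => eqp_r.
have szr : size r = (2 ^ g)%N.
  apply: succn_inj; rewrite -(size_prod_XsubC r id) -(eqp_size eqp_r).
  rewrite size_polyDl size_polyXn // size_polyN size_polyX ltnS.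
  exact: (@leq_pexp2l 2 1 g).
rewrite -szr -(card_uniqP _); last by rewrite mask_uniq // index_enum_uniq.
apply: eq_card => x; rewrite inE frob_fixed_gcd // -root_prod_XsubC.
by rewrite -(eqp_root eqp_r) rootE !hornerE subr_eq0.
Qed.

(** * Absolute trace and kernels of adjoint maps *)

Definition abs_trace (x : F) : F := \sum_(i < n) x ^+ (2 ^ i).

Lemma abs_traceD : {morph abs_trace : x y / x + y}.
Proof.
by move=> x y; rewrite -big_split; apply: eq_bigr => i _; rewrite exprD_pow2.
Qed.

Lemma abs_trace0 : abs_trace 0 = 0.
Proof. by apply: big1 => i _; rewrite expr0n expn_eq0. Qed.

(** Squaring permutes the summands cyclically, as x^(2^n) = x. *)
Lemma abs_trace_sq (x : F) : abs_trace (x ^+ 2) = abs_trace x.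
Proof.
rewrite /abs_trace -[in LHS](expn1 2).
under eq_bigr do rewrite exprXX add1n.
case: n n_gt0 expf_pow2n => // m _ frobm.
by rewrite big_ord_recr big_ord_recl /= frobm addrC.
Qed.

Lemma abs_trace_frob (k : nat) (x : F) : abs_trace (x ^+ (2 ^ k)) = abs_trace x.
Proof.
elim: k => [|k IHk]; first by rewrite expr1.
by rewrite expnSr exprM abs_trace_sq.
Qed.

(** The trace is given by a nonzero polynomial of degree at most 2^(n-1), too small to vanish on all
    2^n elements. *)
Lemma abs_trace_neq0 : exists x, abs_trace x != 0.
Proof.
apply/existsP; apply: contraT; rewrite negb_exists => /forallP tr0.
pose p : {poly F} := \sum_(i < n) 'X^(2 ^ i).
have p_neq0 : p != 0.
  apply/eqP => /(congr1 (fun q : {poly F} => q`_1)); rewrite coef0 coef_sum.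
  rewrite (bigD1 (Ordinal n_gt0)) //= coefXn big1 => [/eqP|i].
    by rewrite addr0 oner_eq0.
  by rewrite coefXn -val_eqE /= -{1}(expn0 2) eqn_exp2l // eq_sym => /negPf->.
have szp : (size p <= (2 ^ n.-1).+1)%N.
  rewrite (leq_trans (size_sum _ _ _)) //; apply/bigmax_leqP => i _.
  by rewrite size_polyXn ltnS leq_pexp2l // -ltnS (ltn_predK n_gt0).
have : (#|F| < size p)%N.
  rewrite cardE; apply: max_poly_roots (enum_uniq _) => //.
  apply/allP => x _; rewrite rootE horner_sum.
  under eq_bigr do rewrite hornerXn.
  by have := tr0 x; rewrite negbK.
move/leq_trans => /(_ _ szp); rewrite hF ltnS -{1}(ltn_predK n_gt0) expnS.
by have := expn_gt0 2 n.-1; lia.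
Qed.

(* Double counting of the pairs (x, y) with T (f x * y) = 0. *)
Lemma card_ker_adjoint (T f h g : F -> F) :
    T 0 = 0 -> (exists x, T x != 0) -> injective h ->
    (forall x y, T (f x * y) = T (h x * g y)) ->
  #|[set x | f x == 0]| = #|[set y | g y == 0]|.
Proof.
move=> T0 [z Tz] h_inj adj.
pose K := #|[set y | T y == 0]|.
have count_y (a : F) :
    (\sum_y (T (a * y)%R == 0%R) = if a == 0%R then #|F| else K)%N.
  case: eqVneq => [->|a_neq0].
    by under eq_bigr do rewrite mul0r T0 eqxx; rewrite sum1_card.
  rewrite /K -sum1dep_card [RHS]big_mkcond [RHS](reindex_inj (mulfI a_neq0)) /=.
  by apply: eq_bigr => y _; case: eqP.
(* Every x contributes [K], and each zero of [u] a further [#|F| - K]; since [K < #|F|], the sum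
   determines the number of zeros. *)
have count_xy (u : F -> F) : (\sum_x (if u x == 0%R then #|F| else K) =
   #|F| * K + #|[set x | u x == 0%R]| * (#|F| - K))%N.
  have leK : (K <= #|F|)%N by apply: max_card.
  rewrite -sum1dep_card big_distrl -sum_nat_const /= [X in (_ + X)%N]big_mkcond.
  rewrite -big_split; apply: eq_bigr => x _; case: eqP => _ /=; last by rewrite addn0.
  by rewrite mul1n subnKC.
have ltK : (K < #|F|)%N.
  rewrite -cardsT; apply: proper_card; rewrite properE subsetT.
  by apply/subsetPn; exists z; rewrite ?inE.
have : (\sum_x \sum_y (T (f x * y)%R == 0%R) =
        \sum_x \sum_y (T (x * g y)%R == 0%R))%N.
  rewrite [RHS](reindex_inj h_inj); apply: eq_bigr => x _.
  by apply: eq_bigr => y _; rewrite adj.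
rewrite [X in _ = X]exchange_big /=; under eq_bigr do rewrite count_y.
under [X in _ = X]eq_bigr => y _ do under eq_bigr => x _ do rewrite mulrC.
under [X in _ = X]eq_bigr do rewrite count_y.
rewrite !count_xy => /addnI/eqP; rewrite eqn_pmul2r ?subn_gt0 //.
by move/eqP.
Qed.

(** * Linearized polynomials and the values of [delta] *)

Definition lin (s : nat) (b x : F) : F := x ^+ (2 ^ s) + b * x ^+ 2 + (b + 1) * x.

Definition lin_adj (t : nat) (b y : F) : F :=
  y ^+ (2 ^ t) + (b + 1) ^+ 2 * y ^+ 2 + b * y.

Definition nker (s : nat) (b : F) : nat := #|[set x | lin s b x == 0]|.

Lemma card_ker_lin_adj (s t : nat) (b : F) : (s + t = n.+1)%N ->
  nker s b = #|[set y | lin_adj t b y == 0]|.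
Proof.
move=> st; apply: (card_ker_adjoint (T := abs_trace) (h := fun x => x ^+ (2 ^ 1))).
- exact: abs_trace0.
- exact: abs_trace_neq0.
- exact: exp_pow2_inj.
move=> x y; rewrite expn1.
have -> : lin s b x * y = x ^+ (2 ^ s) * y + (b + 1) * x * y + b * x ^+ 2 * y.
  by rewrite /lin; ring.
have -> : x ^+ 2 * lin_adj t b y =
    x ^+ 2 * y ^+ (2 ^ t) + ((b + 1) * x * y) ^+ 2 + b * x ^+ 2 * y.
  by rewrite /lin_adj; ring.
(* Raising x^(2^s) y to the power 2^t preserves the trace and gives x^(2^(n+1)) y^(2^t) = x^2
   y^(2^t). *)
rewrite !abs_traceD abs_trace_sq -(abs_trace_frob t (_ * y)).
by rewrite exprMn exprXX st expnSr exprM expf_pow2n.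
Qed.

Lemma lin0 (s : nat) (b : F) : lin s b 0 = 0.
Proof. by rewrite /lin !expr0n expn_eq0 /= !mulr0 !addr0. Qed.

Lemma lin1 (s : nat) (b : F) : lin s b 1 = 0.
Proof. by rewrite /lin !expr1n; have two0 := addxx 1; ring: two0. Qed.

Lemma eq_root_F2 (x : F) : (x * (x + 1) == 0) = (x \in F2 F).
Proof. by rewrite mulf_eq0 addr_eq0_pchar2 !inE. Qed.

Lemma G_F2 (s : nat) (x : F) : (0 < s)%N -> x \in F2 F -> G s (x + 1) + G s x = 1.
Proof.
move=> s0; have s1 : (2 ^ s - 1 == 0)%N = false.
  by apply/negbTE; rewrite subn_eq0 -ltnNge -{1}(expn0 2) ltn_exp2l.
rewrite !inE /G => /orP[]/eqP->.
  by rewrite add0r expr0n s1 expr1n addr0.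
by rewrite addxx expr0n s1 expr1n add0r.
Qed.

Lemma G_mul (s : nat) (x : F) : x * G s x = x ^+ (2 ^ s).
Proof. by rewrite /G -exprS subnS subn0 prednK // expn_gt0. Qed.

Lemma G_lin (s : nat) (b x : F) : x \notin F2 F ->
  (G s (x + 1) + G s x == b) = (lin s b x == 0).
Proof.
rewrite -eq_root_F2 => /mulfI x_inj; rewrite -(inj_eq x_inj) -[LHS]addr_eq0_pchar2.
congr (_ == _).
have -> : x * (x + 1) * (G s (x + 1) + G s x) =
     x * ((x + 1) * G s (x + 1)) + (x + 1) * (x * G s x) by ring.
by rewrite !G_mul exprD_pow2 expr1n /lin; have two0 := addxx 1; ring: two0.
Qed.

(** The 2 accounts for F_2, which lies in the kernel but contains no solution, as the derivative of
    [G s] takes the value 1 there. For b = 1 both its elements are solutions, so no correction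
    occurs. *)
Lemma delta_nker (s : nat) (b : F) : (0 < s)%N -> b != 1 -> (delta s b + 2 = nker s b)%N.
Proof.
move=> s_gt0 b_neq1.
have sub : F2 F \subset [set x | lin s b x == 0].
  by apply/subsetP => x; rewrite !inE => /orP[]/eqP->; rewrite ?lin0 ?lin1.
rewrite /nker -(cardsID (F2 F)) (setIidPr sub) addnC cards2 eq_sym oner_eq0.
congr (_ + _)%N; apply: eq_card => x; rewrite [LHS]inE 2!inE.
have [xF2|xF2] := boolP (x \in F2 F); last by rewrite G_lin ?xF2.
by rewrite G_F2 ?xF2 // eq_sym (negPf b_neq1).
Qed.

Lemma delta1_nker (s : nat) : (0 < s)%N -> delta s (1 : F) = nker s 1.
Proof.
move=> s_gt0; apply: eq_card => x; rewrite 2!inE.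
have [xF2|xF2] := boolP (x \in F2 F); last by rewrite G_lin.
rewrite G_F2 // eqxx; move: xF2; rewrite !inE => /orP[]/eqP->.
  by rewrite lin0 eqxx.
by rewrite lin1 eqxx.
Qed.

Lemma nker0 (s : nat) : (0 < s)%N -> nker s 0 = (2 ^ gcdn s n)%N.
Proof.
move=> s_gt0; rewrite -card_frob_fixed //; apply: eq_card => x.
by rewrite !inE /lin mul0r addr0 add0r mul1r addr_eq0_pchar2.
Qed.

(** L_{s,1}(x) = x^(2^s) + x^2 is the square of x^(2^(s-1)) + x. *)
Lemma nker1 (s : nat) : (1 < s)%N -> nker s 1 = (2 ^ gcdn (s - 1) n)%N.
Proof.
move=> s_gt1; rewrite -card_frob_fixed ?subn_gt0 //; apply: eq_card => x.
rewrite !inE /lin addxx mul0r addr0 mul1r addr_eq0_pchar2.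
rewrite -{1}(subnK (ltnW s_gt1)) -exprXX -[in X in _ == X](expn1 2).
by rewrite (inj_eq (@exp_pow2_inj 1)).
Qed.

Lemma nker_gt1 (s : nat) (b : F) : (1 < nker s b)%N.
Proof.
have <- : #|F2 F| = 2%N by rewrite cards2 eq_sym oner_eq0.
apply: subset_leq_card; apply/subsetP => x.
by rewrite !inE => /orP[]/eqP->; rewrite ?lin0 ?lin1.
Qed.

(** * Rescaling by a kernel element *)

Lemma lin_adj_root (t : nat) (b l : F) : lin_adj t b l = 0 ->
  (b + 1) ^+ 2 * l ^+ 2 = l ^+ (2 ^ t) + b * l.
Proof.
move=> ker_l; apply/eqP; rewrite -addr_eq0_pchar2 -ker_l /lin_adj.
by apply/eqP; ring.
Qed.

Definition swap_coef (t : nat) (b l : F) : F := b * l / l ^+ (2 ^ t) + 1.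

Lemma mul_swap_coef (t : nat) (b l : F) : l != 0 ->
  l ^+ (2 ^ t) * swap_coef t b l = l ^+ (2 ^ t) + b * l.
Proof.
move=> l_neq0; rewrite mulrDr mulr1 mulrC divfK 1?addrC //.
exact: expf_neq0.
Qed.

Section Swap.
Variables (s t : nat) (b l : F).
Hypothesis st : (s + t = n.+1)%N.
Hypotheses (l_neq0 : l != 0) (ker_l : lin_adj t b l = 0).

(** Divided by l^(2^t), A_{t,b}(l z) has z-coefficient b l^(1 - 2^t) = c + 1; that l is a root says
    exactly that its z^2-coefficient is c. *)
Lemma lin_adj_mul (z : F) :
  lin_adj t b (l * z) = l ^+ (2 ^ t) * lin t (swap_coef t b l) z.
Proof.
have e := lin_adj_root ker_l; have e' := mul_swap_coef t b l_neq0.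
have two0 := addxx 1.
rewrite /lin_adj /lin !exprMn; move: e e'.
move: (l ^+ (2 ^ t)) (z ^+ (2 ^ t)) (swap_coef t b l) => m Z c e e'.
have -> : m * (Z + c * z ^+ 2 + (c + 1) * z) =
  m * Z + m * c * z ^+ 2 + (m * c + m) * z by ring.
by rewrite e' [_ ^+ 2 * (_ * _)]mulrA e; ring: two0.
Qed.

Lemma nker_swap : nker s b = nker t (swap_coef t b l).
Proof.
rewrite (card_ker_lin_adj _ st) /nker -!sum1dep_card.
rewrite (reindex_inj (mulfI l_neq0)) /=; apply: eq_bigl => z.
by rewrite lin_adj_mul mulf_eq0 expf_eq0 (negPf l_neq0) andbF.
Qed.

(** c = 0 would force (b + 1) l = 0, and c = 1 would force b l = 0. *)
Lemma swap_coef_F2 : b \notin F2 F -> swap_coef t b l \notin F2 F.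
Proof.
rewrite !inE !negb_or => /andP[b_neq0 b_neq1].
have m_neq0 : l ^+ (2 ^ t) != 0 by rewrite expf_neq0.
apply/andP; split.
  apply/eqP => c_eq0; have := mul_swap_coef t b l_neq0.
  rewrite c_eq0 mulr0 -(lin_adj_root ker_l) -exprMn => /esym/eqP.
  by rewrite expf_eq0 /= mulf_eq0 addr_eq0_pchar2 (negPf b_neq1) (negPf l_neq0).
rewrite -subr_eq0 addrK mulf_neq0 ?invr_eq0 //.
by rewrite mulf_neq0.
Qed.

Lemma lin_adj_swap : lin_adj s (swap_coef t b l) (l ^+ (2 ^ t)) = 0.
Proof.
have e := lin_adj_root ker_l; have e' := mul_swap_coef t b l_neq0.
have two0 := addxx 1.
(* With m = l^(2^t), m^(2^s) = l^(2^(n+1)) = l^2; the value becomes l^2 + (b l)^2 + (b + 1)^2 l^2 =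
   0. *)
rewrite /lin_adj exprXX addnC st expnSr exprM expf_pow2n.
move: e e'.
move: (l ^+ (2 ^ t)) (swap_coef t b l) => m c e e'.
have -> : l ^+ 2 + (c + 1) ^+ 2 * m ^+ 2 + c * m =
  l ^+ 2 + (m * c + m) ^+ 2 + m * c by ring.
rewrite e' -[X in _ + X]e.
have -> : m + b * l + m = b * l by ring: two0.
ring: two0.
Qed.

End Swap.

(** * Counting parameters by kernel size *)

Definition level (s N : nat) : {set F} := [set b in ~: F2 F | nker s b == N].

Definition level_pairs (s t N : nat) : {set F * F} :=
  [set p | (p.1 \in level s N) && ((p.2 != 0) && (lin_adj t p.1 p.2 == 0))].

Lemma card_level_pairs (s t N : nat) : (s + t = n.+1)%N ->
  #|level_pairs s t N| = (#|level s N| * N.-1)%N.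
Proof.
move=> st; rewrite -sum1dep_card -(pair_big_dep (fun b => b \in level s N)
  (fun b l => (l != 0) && (lin_adj t b l == 0)) (fun _ _ => 1%N)) /=.
rewrite -sum_nat_const; apply: eq_bigr => b; rewrite inE => /andP[_ /eqP <-].
rewrite (card_ker_lin_adj _ st) (cardsD1 0) inE /lin_adj !expr0n expn_eq0 /=.
rewrite !mulr0 !addr0 eqxx sum1dep_card; apply: eq_card => l.
by rewrite !inE.
Qed.

Lemma leq_card_level (s t N : nat) : (s + t = n.+1)%N ->
  (#|level s N| <= #|level t N|)%N.
Proof.
move=> st; have ts : (t + s = n.+1)%N by rewrite addnC.
(* For N at most 1 the level is empty, since kernels contain F_2; otherwise the factor N - 1 is
   positive and cancels. *)
have [N_gt1|N_le1] := ltnP 1 N; last first.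
  rewrite (_ : level s N = set0) ?cards0 //; apply/setP => b.
  rewrite !inE; apply/negbTE; rewrite negb_and; apply/orP; right.
  by apply: contraTneq N_le1 => <-; rewrite -ltnNge nker_gt1.
suff : (#|level_pairs s t N| <= #|level_pairs t s N|)%N.
  by rewrite !card_level_pairs // leq_pmul2r //; case: N N_gt1 => [|[]].
pose f (p : F * F) := (swap_coef t p.1 p.2, p.2 ^+ (2 ^ t)).
rewrite -(card_in_imset (f := f)); last first.
  (* The second component determines l by injectivity of Frobenius, and then c determines b. *)
  move=> [b l] [b' l']; rewrite !inE /= => /andP[_ /andP[l0 _]] _.
  case=> e /exp_pow2_inj el; move: e; rewrite -el => /addIr.
  by move/(divIf (expf_neq0 _ l0))/(mulIf l0) ->.
apply: subset_leq_card; apply/subsetP => _ /imsetP[[b l] + ->].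
rewrite !(inE, in_setC) /= => /andP[/andP[bF2 /eqP bN] /andP[l0 /eqP kl]].
have := swap_coef_F2 l0 kl; rewrite !inE => -> //=.
by rewrite -(nker_swap st l0 kl) bN eqxx expf_neq0 //= lin_adj_swap.
Qed.

Lemma card_level (s t N : nat) : (s + t = n.+1)%N ->
  #|level s N| = #|level t N|.
Proof.
by move=> st; apply/eqP; rewrite eqn_leq !leq_card_level // addnC.
Qed.

(** * Multisets of values and the differential spectrum *)

Lemma count_delta_values (s i : nat) : (0 < s)%N ->
  count_mem i (delta_values F s) = #|level s (i + 2)|.
Proof.
move=> s_gt0; rewrite /delta_values count_map -size_filter cardE.
rewrite /image_mem /enum_mem -filter_predI; congr size; apply: eq_filter => b.
rewrite !inE /=; have [|bF2] := boolP (b \in F2 F).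
  by rewrite !inE => ->; rewrite andbF.
move: bF2; rewrite !inE negb_or => /andP[-> b1] /=.
by rewrite -delta_nker ?b1 // andbT eqn_add2r.
Qed.

Lemma perm_delta_values (s t : nat) : (0 < s)%N -> (0 < t)%N ->
  (s + t = n.+1)%N -> perm_eq (delta_values F s) (delta_values F t).
Proof.
move=> s_gt0 t_gt0 st; apply/allP => i _; apply/eqP.
by rewrite !count_delta_values // (card_level _ st).
Qed.

(** Isolates the values at 0 and 1: once the multisets outside F_2 agree, only these can distinguish
    two spectra. *)
Lemma omega_split (s i : nat) :
  omega F s i = (count_mem i (delta_values F s) +
    ((delta s (0 : F)%R == i) + (delta s (1 : F)%R == i)))%N.
Proof.
rewrite /omega (cardsD1 (0 : F)) (cardsD1 (1 : F)) !inE oner_eq0 /= addnA addnC.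
congr (_ + _)%N; rewrite /delta_values count_map -size_filter cardE.
rewrite /image_mem /enum_mem -filter_predI; congr size; apply: eq_filter => b.
rewrite !inE negb_or /=.
by case: (b == 0); case: (b == 1); case: (delta s b == i).
Qed.

End Char2.

Theorem corollary2 (n s t : nat) (F : finFieldType)
    (hF : #|F| = (2 ^ n)%N) (hs : (2 <= s)%N) (ht : (2 <= t)%N)
    (hst : t = (n - s + 1)%N) :
  ((delta s (0 : F))%:Z = (delta t (1 : F))%:Z - 2 /\
   (delta t (1 : F))%:Z - 2 = (2 ^ gcdn (t - 1) n)%N%:Z - 2) /\
  (delta s (1 : F) = (delta t (0 : F)%R + 2)%N /\
   (delta t (0 : F)%R + 2)%N = (2 ^ gcdn t n)%N) /\
  perm_eq (delta_values F s) (delta_values F t) /\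
  (same_differential_spectrum F t s <-> gcdn s n = 1%N /\ gcdn t n = 1%N) /\
  (gcdn s n = 1%N /\ gcdn t n = 1%N -> odd n) /\
  (locally_APN F t <-> locally_APN F s).
Proof.
have st : (s + t = n.+1)%N by lia.
have ts : (t + s = n.+1)%N by rewrite addnC.
have gcd_compl u v : (u + v = n.+1)%N -> (0 < v)%N -> gcdn (v - 1) n = gcdn u n.
  move=> uv v_gt0; have -> : n = (v - 1 + u)%N by lia.
  by rewrite gcdnDl gcdnC gcdnDr.
have d0 u : (1 < u)%N -> (delta u (0 : F)%R + 2 = 2 ^ gcdn u n)%N.
  by move=> u_gt1; rewrite (delta_nker hF) ?(nker0 hF) ?(ltnW u_gt1) // eq_sym
    oner_eq0.
have d1 u : (1 < u)%N -> delta u (1 : F) = (2 ^ gcdn (u - 1) n)%N.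
  by move=> u_gt1; rewrite (delta1_nker hF) ?(nker1 hF) ?(ltnW u_gt1).
have s0 := d0 s hs; have s1 := d1 s hs; have t0 := d0 t ht; have t1 := d1 t ht.
rewrite (gcd_compl _ _ ts (ltnW hs)) in s1.
rewrite (gcd_compl _ _ st (ltnW ht)) in t1.
have perm_st := perm_delta_values hF (ltnW hs) (ltnW ht) st.
(* Local APN-ness depends only on the multiset, so [perm_all] transfers it. *)
have apnP u : locally_APN F u <-> all (leq^~ 2) (delta_values F u).
  split=> [apn | /allP apn b bF2]; last first.
    by apply: apn; rewrite map_f // mem_enum inE.
  by apply/allP => _ /mapP[b + ->]; rewrite mem_enum inE => /apn.
split; first by rewrite (gcd_compl _ _ st (ltnW ht)) t1 -s0; split; lia.
split; first by rewrite t0 s1.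
split=> //.
split; last first.
  split; last by split=> /apnP h; apply/apnP; move: h; rewrite (perm_all _ perm_st).
  case=> gs gt; apply: contraT => n_even.
  (* If n were even, s and t would both be odd, contradicting s + t = n + 1. *)
  have odd_of u : gcdn u n = 1%N -> odd u.
    move=> gu; apply: contraT => u_even.
    have : (2 %| gcdn u n)%N by rewrite dvdn_gcd !dvdn2 u_even n_even.
    by rewrite gu.
  by have := congr1 odd st; rewrite oddD /= (odd_of s gs) (odd_of t gt) n_even.
split=> [spec | [gs gt] i]; last first.
  rewrite !omega_split (permP perm_st); congr (_ + _)%N.
  by move: s0 s1 t0 t1; rewrite gs gt => /(@addIn 2 _ 0)-> -> /(@addIn 2 _ 0)-> ->.
(* This index is [delta t 1], so it must also be attained by s on F_2; [delta s 0] is smaller by 2,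
   which leaves [delta s 1], equal to 2^gcd(t,n). *)
have := spec (2 ^ gcdn s n)%N; rewrite !omega_split (permP perm_st) => /addnI.
have /negPf-> : delta s (0 : F) != (2 ^ gcdn s n)%N by rewrite -s0; lia.
rewrite t1 s1 eqxx addn1 add0n.
case: (2 ^ gcdn t n =P 2 ^ gcdn s n)%N => // /(expnI (ltnSn 1)) eq_gcd _.
(* The common gcd divides both n and s + t = n + 1. *)
have gst : gcdn s n = 1%N.
  apply/eqP; rewrite -dvdn1.
  rewrite -(@dvdn_addr n) ?dvdn_gcdr // addn1 -st dvdn_add ?dvdn_gcdl //.
  by rewrite -eq_gcd dvdn_gcdl.
by rewrite eq_gcd.
Qed.
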